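(* Let $P$ be an exchangeable probability distribution of a finite random vector $(X_v)_{v\in V}$. Then $P$ is faithful to a graph with vertex set $V$ (both under the undirected interpretation and under the bidirected interpretation of the graph) if and only if $P$ satisfies the intersection and composition properties. The graph must then be either empty (no edges) or complete (all edges).
   Context: $V$ is a finite set and the $X_v$ share the same sample space. $P$ is exchangeable if for every permutation $\pi$ of $V$ the permuted vector $(X_{\pi(v)})_{v\in V}$ has the same distribution as $(X_v)_{v\in V}$. For pairwise disjoint $A,B,C\subseteq V$, $A\perp\!\!\!\perp B\mid C$ means that $X_A$ is conditionally independent of $X_B$ given $X_C$ under $P$ (statements with $A=\varnothing$ or $B=\varnothing$ always hold). $P$ satisfies intersection if for all pairwise disjoint $A,B,C,D\subseteq V$: $A\perp\!\!\!\perp B\mid C\cup D$ and $A\perp\!\!\!\perp D\mid C\cup B$ imply $A\perp\!\!\!\perp B\cup D\mid C$. $P$ satisfies composition if for all pairwise disjoint $A,B,C,D\subseteq V$: $A\perp\!\!\!\perp B\mid C$ and $A\perp\!\!\!\perp D\mid C$ imply $A\perp\!\!\!\perp B\cup D\mid C$. Graphs are simple (no loops, no multiple edges). Undirected interpretation: $A\perp_u B\mid C$ if every path between $A$ and $B$ has a vertex in $C$. Bidirected interpretation: $A\perp_b B\mid C$ if every path between $A$ and $B$ has a vertex outside $A\cup B\cup C$. $P$ is faithful to $G$ under the undirected (resp. bidirected) interpretation if for all pairwise disjoint $A,B,C\subseteq V$: $A\perp_u B\mid C\iff A\perp\!\!\!\perp B\mid C$ (resp. $A\perp_b B\mid C\iff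 A\perp\!\!\!\perp B\mid C$). *)

(* Defs.v *)
From HB Require Import structures.
From mathcomp Require Import all_boot all_order all_algebra perm.

Set Implicit Arguments.
Unset Strict Implicit.
Unset Printing Implicit Defensive.

(* Unlike trivIset, this allows the empty set to occur several times. *)
Definition pairwise_disjoint (V : finType) (s : seq {set V}) : bool :=
  pairwise (fun A B : {set V} => [disjoint A & B]) s.

Record sgraph (V : finType) := SGraph {
  adj :> rel V;
  adj_sym : symmetric adj;
  adj_irrefl : irreflexive adj }.

Section graphs.
Context (V : finType) (G : sgraph V).

Definition empty_graph : Prop := forall u v : V, ~~ G u v.

Definition complete_graph : Prop := forall u v : V, u != v -> G u v.

(* The vertices a :: p form a path (without repetition) from A to B. *)
Definition path_between (A B : {set V}) (a : V) (p : seq V) : bool :=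
  [&& a \in A, last a p \in B, path G a p & uniq (a :: p)].

Definition usep (A B C : {set V}) : Prop :=
  forall (a : V) (p : seq V), path_between A B a p ->
    exists2 v, v \in a :: p & v \in C.

Definition bsep (A B C : {set V}) : Prop :=
  forall (a : V) (p : seq V), path_between A B a p ->
    exists2 v, v \in a :: p & v \notin A :|: B :|: C.

End graphs.

(* Required only now because it redefines [disjoint _ & _]. *)
From mathcomp Require Import all_classical all_reals all_analysis.

Import Order.TTheory GRing.Theory Num.Theory.
Import numFieldNormedType.Exports.

Local Open Scope classical_set_scope.
Local Open Scope ring_scope.

Section conditional_independence.
Context (d d' : measure_display) (T : measurableType d) (E : measurableType d').
Context (R : realType) (P : probability T R) (V : finType).

(* f is a version of the conditional probability of F given the sigma-algebra
   generated by G. *)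
Definition is_cond_prob (G : set (set T)) (F : set T) (f : T -> R) : Prop :=
  [/\ measurable_fun [set: g_sigma_algebraType G]
        (f : g_sigma_algebraType G -> R),
      P.-integrable [set: T] (EFin \o f) &
      forall D : set T, G.-sigma.-measurable D ->
        (\int[P]_(x in D) (f x)%:E = P (F `&` D))%E].

Context (X : V -> {RV P >-> E}).

(* Generates the sigma-algebra of the subvector X_A. *)
Definition events_of (A : {set V}) : set (set T) :=
  \bigcup_(v in [set` A]) preimage_set_system [set: T] (X v) measurable.

(* X_A and X_B are conditionally independent given X_C: almost surely
   P(S and U | X_C) = P(S | X_C) P(U | X_C), for all events S of X_A and U of
   X_B. Versions of conditional probabilities always exist and are a.e. unique,
   so it does not matter which ones are taken. *)
Definition cond_indep (A B C : {set V}) : Prop :=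
  forall S U : set T,
    (events_of A).-sigma.-measurable S ->
    (events_of B).-sigma.-measurable U ->
    exists f g h : T -> R,
      [/\ is_cond_prob (events_of C) S f,
          is_cond_prob (events_of C) U g,
          is_cond_prob (events_of C) (S `&` U) h &
          {ae P, forall x, h x = f x * g x}].

(* Generates the product sigma-algebra on the set V -> E of vectors. *)
Definition cylinders : set (set (V -> E)) :=
  \bigcup_(v in [set: V])
    preimage_set_system [set: V -> E] (fun y => y v) measurable.

Definition random_vector (Y : V -> {RV P >-> E}) :
  T -> g_sigma_algebraType cylinders := fun t v => Y v t.

Definition exchangeable : Prop :=
  forall (s : {perm V}) (B : set (g_sigma_algebraType cylinders)),
    measurable B ->
    pushforward P (random_vector (fun v => X (s v))) B =
    pushforward P (random_vector X) B.

Definition intersection_property : Prop :=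
  forall A B C D : {set V}, pairwise_disjoint [:: A; B; C; D] ->
    cond_indep A B (C :|: D) -> cond_indep A D (C :|: B) ->
    cond_indep A (B :|: D) C.

Definition composition_property : Prop :=
  forall A B C D : {set V}, pairwise_disjoint [:: A; B; C; D] ->
    cond_indep A B C -> cond_indep A D C -> cond_indep A (B :|: D) C.

End conditional_independence.

Section faithfulness.
Context (d d' : measure_display) (T : measurableType d) (E : measurableType d').
Context (R : realType) (P : probability T R) (V : finType).
Context (X : V -> {RV P >-> E}) (G : sgraph V).

Definition faithful_undirected : Prop :=
  forall A B C : {set V}, pairwise_disjoint [:: A; B; C] ->
    (usep G A B C <-> cond_indep X A B C).

Definition faithful_bidirected : Prop :=
  forall A B C : {set V}, pairwise_disjoint [:: A; B; C] ->
    (bsep G A B C <-> cond_indep X A B C).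

End faithfulness.

(* Main.v *)
From HB Require Import structures.
Require Import Defs.
From mathcomp Require Import all_boot all_order all_algebra perm.
From mathcomp Require Import fingroup action primitive_action alt.
From mathcomp Require Import all_classical all_reals all_analysis.
From mathcomp Require Import measurable_realfun.

(** Two ingredients carry the proof: a combinatorial one, about abstract ternary
relations on the subsets of V, and a probabilistic one, which shows that
conditional independence is such a relation.

Combinatorics. Call a relation an exchangeable semigraphoid if it is symmetric,
contains the trivial statements, is stable under decomposition and weak union,
and is invariant under permutations of V. Suppose that it moreover satisfies
intersection and composition, and that it contains one statement with nonempty
A, B and with conditioning set C. Decomposition reduces A and B to points, and
invariance then gives independence of every pair given every set of size #|C|.
Composition followed by weak union raises the size of the conditioning set by
one, intersection followed by decomposition lowers it by one; so every pair is
independent given every set, and composition glues the pairs together: all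
statements hold. Hence either all statements hold or only the trivial ones do
([all_or_nothing]), which is exactly separation in the edgeless graph and in
the complete graph, for both interpretations ([faithful_graph_ex]).

Conversely, separation in a graph always satisfies intersection and
composition, in both interpretations. Moreover two vertices are adjacent
exactly when they are not separated by the set of all other vertices
(undirected case), or by the empty set (bidirected case). For a faithful graph
this is a conditional independence statement, so exchangeability makes its
truth value the same for all pairs ([exchangeable_faithful_graph]).

Probability. The graphoid axioms become immediate once conditional
independence is put in the asymmetric form: for every event S of X_A, some
version of P(S | X_C) is also a version of P(S | X_B, X_C) ([cond_indepP]). The
equivalence rests on the existence (Radon-Nikodym) and uniqueness of
conditional probabilities, on the fact that factors known given X_C can be
pulled out of the conditional expectation, and on a pi-lambda argument.
Invariance under permutations holds because conditional independence depends
only on the law of the vector ([cond_indep_law]): conditional probabilities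
taken on the space of vectors pull back to every random vector with that
law. *)

Set Implicit Arguments.
Unset Strict Implicit.
Unset Printing Implicit Defensive.

Import Order.TTheory GRing.Theory Num.Theory.
Import numFieldNormedType.Exports.

(** * Exchangeable semigraphoids *)

(** The symmetric group acts transitively on lists of distinct points; the list
to move enumerates i, j and then C. *)
Lemma perm_map_pair_set (V : finType) (i j i' j' : V) (C C' : {set V}) :
  i != j -> i \notin C -> j \notin C ->
  i' != j' -> i' \notin C' -> j' \notin C' -> #|C| = #|C'| ->
  exists s : {perm V}, [/\ s i = i', s j = j' & s @: C = C'].
Proof.
move=> ij iC jC ij' iC' jC' cC.
have uniq_t (a b : V) (D : {set V}) :
    a != b -> a \notin D -> b \notin D -> uniq (a :: b :: enum D).
  by move=> ab aD bD; rewrite /= !inE !mem_enum negb_or ab aD bD enum_uniq.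
have size_t : size (i :: j :: enum C) == #|C|.+2 by rewrite /= -cardE.
have size_t' : size (i' :: j' :: enum C') == #|C|.+2 by rewrite /= -cardE cC.
pose t := Tuple size_t; pose t' := Tuple size_t'.
have tS : t \in #|C|.+2.-dtuple([set: V]).
  by rewrite inE; apply/andP; split; [exact: uniq_t|exact/fintype.subsetP].
have tS' : t' \in #|C|.+2.-dtuple([set: V]).
  by rewrite inE; apply/andP; split; [exact: uniq_t|exact/fintype.subsetP].
have leV : #|C|.+2 <= #|V|.
  by rewrite -(eqP size_t) -(card_uniqP (uniq_t _ _ _ ij iC jC)) max_card.
have tr := ntransitive_weak leV (Sym_trans V).
have [s _ /(congr1 val) /= [-> -> es]] := atransP2 tr tS tS'.
exists s; split=> //; apply/setP => x; rewrite -[RHS]mem_enum es.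
apply/imsetP/mapP => -[y yC ->]; exists y => //; first by rewrite mem_enum.
by rewrite -mem_enum.
Qed.

Section exchangeable_semigraphoids.
Variable V : finType.
Implicit Types (A B C D : {set V}).
Implicit Types (I J : {set V} -> {set V} -> {set V} -> Prop).

Definition intersective I := forall A B C D,
  pairwise_disjoint [:: A; B; C; D] ->
  I A B (C :|: D) -> I A D (C :|: B) -> I A (B :|: D) C.

Definition compositional I := forall A B C D,
  pairwise_disjoint [:: A; B; C; D] ->
  I A B C -> I A D C -> I A (B :|: D) C.

Definition agree I J := forall A B C,
  pairwise_disjoint [:: A; B; C] -> (I A B C <-> J A B C).

(** [indep_weaken] contains both decomposition and weak union: it allows points
of B to be dropped or to be moved into C. *)
Record exchangeable_semigraphoid I : Prop := ExchangeableSemigraphoid {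
  indep_sym : forall A B C, I A B C -> I B A C;
  indep_weaken : forall A B C A' B' C',
    A' \subset A -> C \subset C' -> B' :|: C' \subset B :|: C ->
    I A B C -> I A' B' C';
  indep0r : forall A C, I A finset.set0 C;
  indep_perm : forall (s : {perm V}) A B C,
    I A B C -> I (s @: A) (s @: B) (s @: C) }.

Lemma disjointMP A B :
  reflect (forall x, x \in A -> x \notin B) (disjoint (mem A) (mem B)).
Proof.
rewrite disjoint_subset.
by apply: (iffP fintype.subsetP) => AB x /AB; rewrite inE.
Qed.

Lemma pairwise_disjoint3P A B C :
  reflect [/\ forall x, x \in A -> x \notin B,
              forall x, x \in A -> x \notin C &
              forall x, x \in B -> x \notin C]
    (pairwise_disjoint [:: A; B; C]).
Proof.
rewrite /pairwise_disjoint /= !andbT -andbA.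
by apply: (iffP and3P) => -[AB AC BC]; split; exact/disjointMP.
Qed.

(** B and D play symmetric roles in intersection and composition; this form
separates what concerns each of them. *)
Lemma pairwise_disjoint4 A B C D :
  pairwise_disjoint [:: A; B; C; D] =
  [&& pairwise_disjoint [:: A; B; C], pairwise_disjoint [:: A; D; C] &
      disjoint (mem B) (mem D)].
Proof.
rewrite /pairwise_disjoint /= !andbT (fintype.disjoint_sym (mem D)).
by do !case: (disjoint _ _).
Qed.

Lemma pairwise_disjoint4U A B C D : pairwise_disjoint [:: A; B; C; D] ->
  [/\ pairwise_disjoint [:: A; B; C :|: D],
      pairwise_disjoint [:: A; D; C :|: B] &
      pairwise_disjoint [:: A; B :|: D; C]].
Proof.
rewrite /pairwise_disjoint /= !andbT -!finset.setI_eq0 !finset.setIUr.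
rewrite !finset.setIUl !finset.setU_eq0 (finset.setIC D C) (finset.setIC D B).
by do !case: (_ == finset.set0).
Qed.

Lemma agree_intersective I J : agree J I -> intersective J -> intersective I.
Proof.
move=> JI Jint A B C D dABCD /JI IB /JI ID.
have [dB dD dBD] := pairwise_disjoint4U dABCD.
by apply/JI => //; apply: Jint => //; [exact: IB|exact: ID].
Qed.

Lemma agree_compositional I J :
  agree J I -> compositional J -> compositional I.
Proof.
move=> JI Jcomp A B C D dABCD /JI IB /JI ID.
have [_ _ dBD] := pairwise_disjoint4U dABCD.
have := dABCD; rewrite pairwise_disjoint4 => /and3P[dB dD _].
by apply/JI => //; apply: Jcomp => //; [exact: IB|exact: ID].
Qed.

Lemma compositional_points I A B C :
  (forall A C, I A finset.set0 C) -> compositional I ->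
  pairwise_disjoint [:: A; B; C] ->
  (forall b, b \in B -> I A [set b]%SET C) -> I A B C.
Proof.
move=> I0 Icomp.
have [n] := ubnP #|B|; elim: n B => // n IHn B Bn dABC IB.
have [->|[b bB]] := set_0Vmem B; first exact: I0.
rewrite -(finset.setD1K bB).
have /pairwise_disjoint3P[AB AC BC] := dABC.
apply: Icomp.
- rewrite pairwise_disjoint4; apply/and3P; split.
  + apply/pairwise_disjoint3P; split=> // x.
      by move=> /AB; apply: contraNN; rewrite inE => /eqP->.
    by rewrite inE => /eqP ->; exact: BC.
  + apply/pairwise_disjoint3P; split=> // x.
      by move=> /AB; apply: contraNN; rewrite !inE => /andP[].
    by rewrite !inE => /andP[_]; exact: BC.
  + by apply/disjointMP => x; rewrite !inE => ->.
- exact: IB.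
- apply: IHn.
  + by move: Bn; rewrite (finset.cardsD1 b) bB.
  + apply/pairwise_disjoint3P; split=> // x.
      by move=> /AB; apply: contraNN; rewrite !inE => /andP[].
    by rewrite !inE => /andP[_]; exact: BC.
  + by move=> c; rewrite !inE => /andP[_]; exact: IB.
Qed.

(** Permutation invariance makes independence of a pair depend only on the size
of the conditioning set; composition and intersection move that size up and
down, so that one nontrivial statement forces all the others. *)
Lemma all_or_nothing I :
  exchangeable_semigraphoid I -> intersective I -> compositional I ->
  (forall A B C, pairwise_disjoint [:: A; B; C] -> I A B C) \/
  (forall A B C, pairwise_disjoint [:: A; B; C] -> I A B C ->
    A = finset.set0 \/ B = finset.set0).
Proof.
move=> [Isym Iweak I0 Iperm] Iint Icomp.
pose Q k := forall i j C, i != j -> i \notin C -> j \notin C ->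
  #|C| = k -> I [set i]%SET [set j]%SET C.
have d4 (i j l : V) C : i != j -> i != l -> j != l ->
    i \notin C -> j \notin C -> l \notin C ->
    pairwise_disjoint [:: [set i]%SET; [set j]%SET; C; [set l]%SET].
  move=> ij il jl iC jC lC; rewrite /pairwise_disjoint /= !finset.disjoints1.
  rewrite (fintype.disjoint_sym (mem C)) finset.disjoints1.
  by rewrite !inE ij il jl iC jC lC.
(* Composition: i is independent of {j, l} given C minus l; then weak union
   moves l back into the conditioning set. *)
have Qup k : Q k -> Q k.+1.
  move=> Qk i j C ij iC jC Ck.
  have [l lC] : exists l, l \in C by apply/card_gt0P; rewrite Ck.
  pose C0 := (C :\ l)%SET.
  have C0k : #|C0| = k by apply/eqP; rewrite -eqSS -Ck (finset.cardsD1 l C) lC.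
  have il : i != l by apply: contraNneq iC => ->.
  have jl : j != l by apply: contraNneq jC => ->.
  have iC0 : i \notin C0 by rewrite !inE (negbTE iC) andbF.
  have jC0 : j \notin C0 by rewrite !inE (negbTE jC) andbF.
  have lC0 : l \notin C0 by rewrite !inE eqxx.
  have := Icomp _ _ _ _ (d4 i j l C0 ij il jl iC0 jC0 lC0).
  move=> /(_ (Qk _ _ _ ij iC0 jC0 C0k) (Qk _ _ _ il iC0 lC0 C0k)).
  apply: Iweak.
  + exact: fintype.subxx.
  + exact: finset.subD1set.
  + by rewrite -finset.setUA finset.setD1K.
(* Intersection applied to i, j and a point l outside of C; the bound on k
   says that such a point exists. *)
have Qdown k : k.+3 <= #|V| -> Q k.+1 -> Q k.
  move=> kV Qk i j C ij iC jC Ck.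
  have [l] : exists l, l \in ~: (i |: (j |: C))%SET.
    apply/card_gt0P; rewrite finset.cardsCs finset.setCK !finset.cardsU1 !inE.
    by rewrite Ck negb_or ij iC jC subn_gt0.
  rewrite !inE !negb_or ![l == _]eq_sym => /and3P[il jl lC].
  have Cl : #|C :|: [set l]%SET| = k.+1.
    by rewrite finset.setUC finset.cardsU1 lC Ck.
  have Cj : #|C :|: [set j]%SET| = k.+1.
    by rewrite finset.setUC finset.cardsU1 jC Ck.
  have := Iint _ _ _ _ (d4 _ _ _ _ ij il jl iC jC lC).
  move=> /(_ (Qk _ _ _ ij _ _ Cl) (Qk _ _ _ il _ _ Cj)).
  rewrite !inE !negb_or ij il iC jC lC jl eq_sym jl => /(_ isT isT isT isT).
  apply: Iweak => //.
  by apply: finset.setSU; exact: finset.subsetUl.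
have [[A [B [C [dABC [IABC [i iA] [j jB]]]]]]|none] := pselect (exists A B C,
    pairwise_disjoint [:: A; B; C] /\
    [/\ I A B C, exists i, i \in A & exists j, j \in B]); last first.
  right=> A B C dABC IABC.
  have [->|[i iA]] := set_0Vmem A; first by left.
  have [->|[j jB]] := set_0Vmem B; first by right.
  by case: none; exists A, B, C; split=> //; split=> //; [exists i|exists j].
left.
have /pairwise_disjoint3P[AB AC BC] := dABC.
have ij : i != j by apply: contraTneq jB => <-; exact: AB.
have [iC jC] : i \notin C /\ j \notin C by split; [exact: AC|exact: BC].
have QC : Q #|C|.
  move=> i' j' C' ij' iC' jC' CC'.
  have [s [<- <- <-]] :=
    perm_map_pair_set ij iC jC ij' iC' jC' (esym CC').
  rewrite -!finset.imset_set1; apply: Iperm.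
  apply: Iweak IABC => //; first by rewrite finset.sub1set.
  by apply: finset.setSU; rewrite finset.sub1set.
have CV : #|C|.+2 <= #|V|.
  have := max_card (mem (i |: (j |: C))%SET).
  by rewrite !finset.cardsU1 !inE negb_or ij iC jC.
have Q0 : Q 0.
  move: #|C| CV QC; elim=> // k IHk kV Qk; apply: IHk; first exact: ltnW.
  exact: Qdown.
have Qall k : Q k by elim: k => // k; exact: Qup.
move=> A' B' C' dABC'.
have /pairwise_disjoint3P[AB' AC' BC'] := dABC'.
apply: compositional_points => // b bB'; apply: Isym.
apply: compositional_points => //.
  apply/pairwise_disjoint3P; split=> x.
  - by rewrite inE => /eqP ->; apply: contraL bB'; exact: AB'.
  - by rewrite inE => /eqP ->; exact: BC'.
  - exact: AC'.
move=> a aA'; apply: (Qall #|C'|) => //; [|exact: BC'|exact: AC'].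
by apply: contraTneq bB' => ->; exact: AB'.
Qed.

End exchangeable_semigraphoids.

(** * Separation in graphs *)

Section graph_separation.
Variables (V : finType) (G : sgraph V).
Implicit Types (A B C D S : {set V}).

(** Cutting a path at its first visit to S. This is how a path from A to the
union of B and D becomes a path to B that avoids D, or the other way round. *)
Lemma first_hit S a p :
  path G a p -> uniq (a :: p) -> last a p \in S ->
  exists q, [/\ path G a q, uniq (a :: q), {subset q <= p}, last a q \in S &
    forall v, v \in a :: q -> v \in S -> v = last a q].
Proof.
elim: p a => [|b p IHp] a /= Gp up lp.
  by exists [::]; split=> // v; rewrite inE => /eqP.
have [aS|aS] := boolP (a \in S).
  by exists [::]; split=> // v; rewrite inE => /eqP.
have /andP[ab bp] := Gp; have /andP[abp ubp] := up.
have [q [Gq uq qp lq firstq]] := IHp b bp ubp lp.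
have sub : {subset b :: q <= b :: p}.
  by move=> x; rewrite !inE => /orP[->//|/qp ->]; rewrite orbT.
exists (b :: q); split=> //=.
- by rewrite ab.
- by rewrite (contra (sub a) abp).
- move=> v; rewrite inE => /orP[/eqP-> aS'|]; last exact: firstq.
  by rewrite aS' in aS.
Qed.

Lemma usep_intersective : intersective (usep G).
Proof.
move=> A B C D dABCD AB AD a p /and4P[aA lp Gp up].
have [_ _ /pairwise_disjoint3P[_ _ BDC]] := pairwise_disjoint4U dABCD.
have BD : forall x, x \in B -> x \notin D.
  by apply/disjointMP; move: dABCD; rewrite pairwise_disjoint4 => /and3P[].
have [q [Gq uq qp lq firstq]] := first_hit Gp up lp.
have sub v : v \in a :: q -> v \in a :: p.
  by rewrite !inE => /orP[->//|/qp ->]; rewrite orbT.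
have hit S : (forall v, v \in S -> v \in B :|: D) -> last a q \notin S ->
    (exists2 v, v \in a :: q & v \in C :|: S) ->
    exists2 v, v \in a :: p & v \in C.
  move=> SBD lS [v vq]; rewrite finset.in_setU => /orP[vC|vS].
    by exists v => //; exact: sub.
  by move: (vS); rewrite (firstq v vq (SBD _ vS)) (negbTE lS).
move: lq; rewrite finset.in_setU => /orP[lB|lD].
- apply: (hit D); first by move=> v vD; rewrite finset.in_setU vD orbT.
    exact: BD.
  by apply: AB; apply/and4P.
- apply: (hit B); first by move=> v vB; rewrite finset.in_setU vB.
    by apply: contraL lD => /BD.
  by apply: AD; apply/and4P.
Qed.

Lemma usep_compositional : compositional (usep G).
Proof.
move=> A B C D _ AB AD a p /and4P[aA + Gp up].
rewrite finset.in_setU => /orP[lB|lD].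
- by apply: AB; apply/and4P.
- by apply: AD; apply/and4P.
Qed.

Lemma bsep_intersective : intersective (bsep G).
Proof.
move=> A B C D _ AB AD a p /and4P[aA + Gp up].
rewrite finset.in_setU => /orP[lB|lD].
- have [|v vp] := AB a p; first exact/and4P.
  rewrite !inE => v0; exists v => //; rewrite !inE; apply: contra v0.
  by case/orP => [/orP[->//|/orP[->|->]]|->]; rewrite ?orbT.
- have [|v vp] := AD a p; first exact/and4P.
  rewrite !inE => v0; exists v => //; rewrite !inE; apply: contra v0.
  by case/orP => [/orP[->//|/orP[->|->]]|->]; rewrite ?orbT.
Qed.

Lemma bsep_compositional : compositional (bsep G).
Proof.
move=> A B C D dABCD AB AD a p /and4P[aA lp Gp up].
have BD : forall x, x \in B -> x \notin D.
  by apply/disjointMP; move: dABCD; rewrite pairwise_disjoint4 => /and3P[].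
have [q [Gq uq qp lq firstq]] := first_hit Gp up lp.
have sub v : v \in a :: q -> v \in a :: p.
  by rewrite !inE => /orP[->//|/qp ->]; rewrite orbT.
have hit S S' : S :|: S' = B :|: D -> last a q \notin S' ->
    (exists2 v, v \in a :: q & v \notin A :|: S :|: C) ->
    exists2 v, v \in a :: p & v \notin A :|: (B :|: D) :|: C.
  move=> SBD lS [v vq vSC]; exists v; first exact: sub.
  rewrite -SBD; apply: contra vSC; rewrite !inE.
  case/orP => [/or3P[->//|->|vS']|->]; rewrite ?orbT//.
  have vBD : v \in B :|: D by rewrite -SBD finset.in_setU vS' orbT.
  by move: (vS'); rewrite (firstq v vq vBD) (negbTE lS).
move: lq; rewrite finset.in_setU => /orP[lB|lD].
- by apply: (hit B D) => //; [exact: BD|apply: AB; apply/and4P].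
- apply: (hit D B); first by rewrite finset.setUC.
    by apply: contraL lD => /BD.
  by apply: AD; apply/and4P.
Qed.

Lemma empty_graph_no_path A B a p :
  empty_graph G -> disjoint (mem A) (mem B) -> ~~ path_between G A B a p.
Proof.
move=> G0 /disjointMP AB; apply/negP => /and4P[aA + + _].
case: p => [/= aB _|b p _ /=]; last by rewrite (negbTE (G0 a b)).
by move: (AB _ aA); rewrite aB.
Qed.

Lemma path_between_eq0 A B a p :
  A = finset.set0 \/ B = finset.set0 -> ~~ path_between G A B a p.
Proof. by move=> AB0; apply/negP => /and4P[]; case: AB0 => ->; rewrite inE. Qed.

Lemma complete_graph_inseparable A B C :
  complete_graph G -> pairwise_disjoint [:: A; B; C] ->
  usep G A B C \/ bsep G A B C -> A = finset.set0 \/ B = finset.set0.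
Proof.
move=> G1 /pairwise_disjoint3P[AB AC BC] sep.
have [->|[a aA]] := set_0Vmem A; first by left.
have [->|[b bB]] := set_0Vmem B; first by right.
have ab : a != b by apply: contraTneq bB => <-; exact: AB.
have edge : path_between G A B a [:: b].
  by rewrite /path_between /= aA bB G1// inE ab.
case: sep => /(_ _ _ edge)[v]; rewrite !inE => /orP[] /eqP -> {v}.
- by rewrite (negbTE (AC _ aA)).
- by rewrite (negbTE (BC _ bB)).
- by rewrite aA.
- by rewrite bB orbT.
Qed.

(** The second vertex of the path is the required one. Hence two nonadjacent
vertices are separated by all other vertices in the undirected sense, and by
the empty set in the bidirected sense. *)
Lemma nonadjacent_path a b u p : ~~ G a b ->
  path_between G [set a]%SET [set b]%SET u p -> a != b ->
  exists2 v, v \in u :: p & v \notin [set a; b]%SET.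
Proof.
move=> Gab /and4P[]; rewrite !finset.in_set1 => /eqP -> lp Gp up ab.
case: p lp Gp up => [/= ab'|c p lp]; first by rewrite (eqP ab') eqxx in ab.
move=> /= /andP[Gac _] /andP[]; rewrite inE negb_or => /andP[ac _] _.
exists c; first by rewrite !inE eqxx orbT.
rewrite !inE eq_sym negb_or ac/=.
by apply: contraNneq Gab => <-.
Qed.

End graph_separation.

(** * Graphs faithful to an exchangeable semigraphoid *)

Section exchangeable_graphs.
Variable V : finType.
Implicit Types (G : sgraph V) (I : {set V} -> {set V} -> {set V} -> Prop).

Definition edgeless_sgraph : sgraph V :=
  @SGraph V (fun _ _ => false) (fun _ _ => erefl) (fun _ => erefl).

Lemma neq_sym : symmetric (fun u v : V => u != v).
Proof. by move=> u v; rewrite eq_sym. Qed.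

Lemma neq_irrefl : irreflexive (fun u v : V => u != v).
Proof. by move=> u; rewrite eqxx. Qed.

Definition all_edges_sgraph : sgraph V :=
  @SGraph V (fun u v => u != v) neq_sym neq_irrefl.

Lemma faithful_graph_ex I :
  exchangeable_semigraphoid I -> intersective I -> compositional I ->
  exists G, agree (usep G) I /\ agree (bsep G) I.
Proof.
move=> Iex Iint Icomp; have [Iall|Inone] := all_or_nothing Iex Iint Icomp.
  have no_path A B C a p : pairwise_disjoint [:: A; B; C] ->
      ~~ path_between edgeless_sgraph A B a p.
    move=> /pairwise_disjoint3P[AB _ _]; apply: empty_graph_no_path => //.
    exact/disjointMP.
  exists edgeless_sgraph.
  split=> A B C dABC; split=> [_|_ a p]; try exact: Iall.
    by rewrite (negbTE (no_path _ _ _ _ _ dABC)).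
  by rewrite (negbTE (no_path _ _ _ _ _ dABC)).
have I0 A B C : A = finset.set0 \/ B = finset.set0 -> I A B C.
  have [Isym _ I0r _] := Iex.
  by move=> [->|->]; [apply: Isym|]; exact: I0r.
have complete : complete_graph all_edges_sgraph by [].
exists all_edges_sgraph; split=> A B C dABC; split.
- by move=> sep; apply/I0/(complete_graph_inseparable complete dABC); left.
- move=> /(Inone _ _ _ dABC) AB0 a p.
  by rewrite (negbTE (path_between_eq0 _ _ _ AB0)).
- by move=> sep; apply/I0/(complete_graph_inseparable complete dABC); right.
- move=> /(Inone _ _ _ dABC) AB0 a p.
  by rewrite (negbTE (path_between_eq0 _ _ _ AB0)).
Qed.

(** Adjacency of u and v is read off from one conditional independence
statement: given all the other vertices for undirected separation, given the
empty set for bidirected separation. A permutation carries any pair of vertices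
and this conditioning set to any other such pair. *)
Lemma exchangeable_faithful_graph I G : exchangeable_semigraphoid I ->
  agree (usep G) I \/ agree (bsep G) I -> empty_graph G \/ complete_graph G.
Proof.
move=> [_ _ _ Iperm] faithful.
have [[u [v Guv]]|noedge] := pselect (exists u v, G u v); last first.
  by left=> u v; apply/negP => Guv; apply: noedge; exists u, v.
right=> u' v' uv'; apply/negPn/negP => nGuv'.
have uv : u != v.
  by apply: contraTneq Guv => ->; rewrite adj_irrefl.
have d3 (a b : V) (C : {set V}) : a != b -> a \notin C -> b \notin C ->
    pairwise_disjoint [:: [set a]%SET; [set b]%SET; C].
  move=> ab aC bC.
  by rewrite /pairwise_disjoint /= !finset.disjoints1 !inE ab aC bC.
have edge : path_between G [set u]%SET [set v]%SET u [:: v].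
  by rewrite /path_between /= !inE !eqxx Guv uv.
have [agr|agr] := faithful.
- pose C := (~: [set u; v])%SET; pose C' := (~: [set u'; v'])%SET.
  have uC : u \notin C by rewrite !inE eqxx.
  have vC : v \notin C by rewrite !inE eqxx orbT.
  have uC' : u' \notin C' by rewrite !inE eqxx.
  have vC' : v' \notin C' by rewrite !inE eqxx orbT.
  have cC : #|C'| = #|C|.
    rewrite [LHS]finset.cardsCs [RHS]finset.cardsCs !finset.setCK.
    by rewrite !finset.cards2 uv uv'.
  have [s [su sv sC]] := perm_map_pair_set uv' uC' vC' uv uC vC cC.
  have sep' : usep G [set u']%SET [set v']%SET C'.
    move=> a p ap; have [w wp wuv] := nonadjacent_path nGuv' ap uv'.
    by exists w => //; rewrite finset.in_setC.
  have /(Iperm s) := (agr _ _ _ (d3 _ _ _ uv' uC' vC')).1 sep'.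
  rewrite !finset.imset_set1 su sv sC.
  move=> /(agr _ _ _ (d3 _ _ _ uv uC vC)).2 /(_ _ _ edge)[w].
  by rewrite !inE => ->.
- have n0 (a : V) : a \notin finset.set0 by rewrite inE.
  have [s [su sv _]] :=
    perm_map_pair_set uv' (n0 _) (n0 _) uv (n0 _) (n0 _) erefl.
  have sep' : bsep G [set u']%SET [set v']%SET finset.set0.
    move=> a p ap; have [w wp wuv] := nonadjacent_path nGuv' ap uv'.
    by exists w => //; rewrite finset.setU0.
  have /(Iperm s) := (agr _ _ _ (d3 _ _ _ uv' (n0 _) (n0 _))).1 sep'.
  rewrite !finset.imset_set1 su sv finset.imset0.
  move=> /(agr _ _ _ (d3 _ _ _ uv (n0 _) (n0 _))).2 /(_ _ _ edge)[w].
  by rewrite !inE orbF => ->.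
Qed.

End exchangeable_graphs.

(** * Conditional probabilities *)

Local Open Scope classical_set_scope.
Local Open Scope ring_scope.

Section conditional_probability.
Context d (T : measurableType d) (R : realType) (P : probability T R).

Lemma integral_mrestr (U : set T) (mU : measurable U) (D : set T)
    (f : T -> \bar R) :
  measurable D -> measurable_fun D f ->
  (forall x, D x -> (0 <= f x)%E) ->
  (\int[mrestr P mU]_(x in D) f x = \int[P]_(x in D `&` U) f x)%E.
Proof.
move=> mD mf f0; rewrite (ge0_negligible_integral (N := ~` U))//; first last.
- by rewrite /= /mrestr setICl measure0.
- exact: measurableC.
rewrite setDE setCK; apply: eq_measure_integral => A mA AU.
by rewrite /= /mrestr setIidl// => x /AU[].
Qed.

Section sub_sigma_algebra.
Variable G : set (set T).
Hypothesis Gm : G `<=` measurable.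

Lemma g_sigma_algebra_measurable : <<s G >> `<=` measurable.
Proof. exact: smallest_sub (@sigma_algebra_measurable _ T) Gm. Qed.

(** The measurable space with the smaller sigma-algebra is a different type, on
which the restriction of P is the law of the identity map. *)
Let coarsen : T -> g_sigma_algebraType G := idfun.

Let measurable_coarsen : measurable_fun setT coarsen.
Proof. by move=> _ Y mY; rewrite setTI; exact: g_sigma_algebra_measurable. Qed.

Lemma measurable_fun_coarse d' (E : measurableType d')
    (f : T -> E) :
  measurable_fun [set: g_sigma_algebraType G]
    (f : g_sigma_algebraType G -> E) ->
  measurable_fun [set: T] f.
Proof. by move=> mf; exact: (measurableT_comp mf measurable_coarsen). Qed.

HB.instance Definition _ :=
  isMeasurableFun.Build _ _ _ _ coarsen measurable_coarsen.

Let Q : probability (g_sigma_algebraType G) R := distribution P coarsen.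

Lemma cond_prob_ae_unique (F : set T) (f g : T -> R) :
  is_cond_prob P G F f -> is_cond_prob P G F g -> {ae P, forall x, f x = g x}.
Proof.
move=> [mf intf If] [mg intg Ig].
have mEf := (measurable_EFinP _ _).2 mf.
have mEg := (measurable_EFinP _ _).2 mg.
have [N [mN N0 fgN]] : ae_eq Q setT (EFin \o f) (EFin \o g).
  apply: integral_ae_eq => //.
    exact: (integrable_pushforward measurable_coarsen).
  move=> D _ mD.
  have mD' := g_sigma_algebra_measurable mD.
  rewrite !(integral_pushforward measurable_coarsen)//.
  - by rewrite If// Ig.
  - by apply: integrableS intg.
  - by apply: integrableS intf.
exists N; split => //; first exact: g_sigma_algebra_measurable.
by move=> x /= fgx; apply: fgN => /= /(_ I)[].
Qed.

Section existence.
Variables (F : set T) (mF : measurable F).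

(** The conditional probability of F is the Radon-Nikodym derivative of this
measure, D |-> P (D and F), with respect to P on the smaller sigma-algebra. *)
Let nu : set (g_sigma_algebraType G) -> \bar R :=
  pushforward (mrestr P mF) coarsen.

Let nu0 : nu set0 = 0%E.
Proof. exact: measure0. Qed.

Let nu_ge0 D : (0 <= nu D)%E.
Proof. exact: measure_ge0. Qed.

Let nu_sigma_additive : semi_sigma_additive nu.
Proof.
by apply: measure_semi_sigma_additive; exact: measurable_coarsen.
Qed.

HB.instance Definition _ :=
  isMeasure.Build _ _ _ nu nu0 nu_ge0 nu_sigma_additive.

Let nu_fin : fin_num_fun nu.
Proof. by move=> D /g_sigma_algebra_measurable mD; exact: fin_num_measure. Qed.

HB.instance Definition _ := Measure_isFinite.Build _ _ _ nu nu_fin.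

(** The last clause is the rule that a factor which is measurable with respect
to G can be pulled out: E[f 1_F | G] = f P(F | G). It is the change of variables
formula for the derivative, hence stated for the version constructed here. *)
Lemma cond_prob_ex :
  exists g : T -> R,
    [/\ forall x, 0 <= g x, is_cond_prob P G F g &
        forall (f : T -> R) (D : set T), (forall x, 0 <= f x) ->
          measurable_fun [set: g_sigma_algebraType G]
            (f : g_sigma_algebraType G -> R) ->
          G.-sigma.-measurable D ->
          (\int[P]_(x in D) (f x * g x)%:E =
           \int[P]_(x in D `&` F) (f x)%:E)%E].
Proof.
have nuQ : nu `<< Q.
  apply/null_content_dominatesP => D mD QD0.
  have mD' := g_sigma_algebra_measurable mD.
  apply/eqP; rewrite -measure_le0 -[leRHS]QD0 /=.
  by apply: le_measure; rewrite ?inE//; exact: measurableI.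
pose r := Radon_Nikodym_SigmaFinite.f nu Q.
have r0 x : (0 <= r x)%E by exact: Radon_Nikodym_SigmaFinite.f_ge0.
have rfin x : r x \is a fin_num by exact: Radon_Nikodym_SigmaFinite.f_fin_num.
have intr : Q.-integrable setT r.
  by exact: Radon_Nikodym_SigmaFinite.f_integrable.
have mr := measurable_int _ intr.
have rE : r = EFin \o (fine \o r) by apply/funext => x /=; rewrite fineK.
have chg (f : T -> R) (D : set T) : (forall x, 0 <= f x) ->
    measurable_fun [set: g_sigma_algebraType G]
            (f : g_sigma_algebraType G -> R) ->
    G.-sigma.-measurable D ->
    (\int[P]_(x in D) (f x * fine (r x))%:E =
     \int[P]_(x in D `&` F) (f x)%:E)%E.
  move=> f0 mf mD.
  have mD' := g_sigma_algebra_measurable mD.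
  have mEf := (measurable_EFinP _ _).2 mf.
  transitivity (\int[Q]_(x in D) ((f x)%:E * r x))%E.
    rewrite ge0_integral_pushforward//.
    - by apply: eq_integral => x _ /=; rewrite EFinM fineK.
    - by apply: emeasurable_funM; apply: measurable_funTS.
    - by move=> x _; rewrite mule_ge0// lee_fin.
  rewrite Radon_Nikodym_SigmaFinite.change_of_variables//;
    last exact: measurable_funTS.
  transitivity (\int[mrestr P mF]_(x in D) (f x)%:E)%E.
    rewrite ge0_integral_pushforward//; first exact: measurable_funTS.
    by move=> x _; rewrite lee_fin.
  rewrite integral_mrestr//.
  - by apply: measurable_funTS; apply/measurable_EFinP/measurable_fun_coarse.
  - by move=> x _; rewrite lee_fin.
exists (fine \o r); split=> //.
  by move=> x /=; exact: fine_ge0.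
split.
- by apply/measurable_EFinP; rewrite -rE.
- rewrite -rE; apply/integrableP; split; first exact: measurable_fun_coarse.
  have /integrableP[_] := intr.
  rewrite ge0_integral_pushforward//; exact: measurableT_comp.
move=> D mD; have := chg (cst 1) D (fun=> ler01) (measurable_cst _) mD.
under eq_integral do rewrite mul1r.
move=> ->; rewrite (integral_cst P _ 1%:E) ?mul1e 1?setIC//.
by apply: measurableI => //; exact: g_sigma_algebra_measurable.
Qed.

End existence.
End sub_sigma_algebra.
End conditional_probability.

Section sub_sigma_algebra_order.
Context d (T : measurableType d) (R : realType) (P : probability T R).

Lemma g_sigma_algebraT (G : set (set T)) : <<s G >> setT.
Proof. exact: (@measurableT _ (g_sigma_algebraType G)). Qed.

Lemma g_sigma_algebraI (G : set (set T)) (D D' : set T) :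
  <<s G >> D -> <<s G >> D' -> <<s G >> (D `&` D').
Proof. exact: (@measurableI _ (g_sigma_algebraType G)). Qed.

Lemma measurable_fun_coarser (G H : set (set T)) (f : T -> R) :
  G `<=` <<s H >> ->
  measurable_fun [set: g_sigma_algebraType G]
    (f : g_sigma_algebraType G -> R) ->
  measurable_fun [set: g_sigma_algebraType H]
    (f : g_sigma_algebraType H -> R).
Proof.
move=> GH mf _ Y mY.
have sub : <<s G >> `<=` <<s H >>.
  exact: smallest_sub (smallest_sigma_algebra _ _) GH.
by apply: sub; exact: mf.
Qed.

Lemma cond_prob_coarser (G H : set (set T)) (F : set T) (f : T -> R) :
  G `<=` <<s H >> ->
  measurable_fun [set: g_sigma_algebraType G]
    (f : g_sigma_algebraType G -> R) ->
  is_cond_prob P H F f -> is_cond_prob P G F f.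
Proof.
move=> GH mf [_ intf If]; split=> // D mD; apply: If.
exact: (smallest_sub (smallest_sigma_algebra _ _) GH).
Qed.

(** Both sides are finite measures in D, so they agree as soon as they agree on
a generating pi-system. *)
Lemma integral_g_sigma_algebra (H : set (set T)) (F : set T) (f : T -> R) :
  setI_closed H -> H setT -> H `<=` measurable -> measurable F ->
  (forall x, 0 <= f x) -> measurable_fun setT f ->
  (forall D, H D -> (\int[P]_(x in D) (f x)%:E = P (F `&` D))%E) ->
  forall D, <<s H >> D -> (\int[P]_(x in D) (f x)%:E = P (F `&` D))%E.
Proof.
move=> HI HT Hm mF f0 mf If D.
have mEf := (measurable_EFinP _ _).2 mf.
have f0' x : (0 <= (f x)%:E)%E by rewrite lee_fin.
pose K := [set D | measurable D /\ (\int[P]_(x in D) (f x)%:E = P (F `&` D))%E].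
suff /(_ D) KH : <<s H >> `<=` K by move=> /KH[].
rewrite -setI_closed_g_dynkin_g_sigma_algebra//.
apply: smallest_sub; last first.
  by move=> W HW; split; [exact: Hm|exact: If].
split.
- by split=> //; exact: If.
- move=> W [mW IW]; split; first exact: measurableC.
  have := If _ HT; rewrite -(setUv W) ge0_integral_setU//; last 3 first.
  + exact: measurableC.
  + exact: measurable_funTS.
  + by apply/disj_set2P; exact: setICr.
  have mFW : measurable (F `&` W) by exact: measurableI.
  have mFCW : measurable (F `&` ~` W).
    by apply: measurableI => //; exact: measurableC.
  rewrite IW setIUr measureU//; last by rewrite setIACA setICr setI0.
  move=> /(congr1 (fun z => z - P (F `&` W))%E).
  by rewrite ![(P (F `&` W) + _)%E]addeC !addeK// fin_num_measure.
- move=> W tW KW; split.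
    by apply: bigcup_measurable => k _; exact: (KW k).1.
  rewrite ge0_integral_bigcup//; last 2 first.
  + by move=> k; exact: (KW k).1.
  + exact: measurable_funTS.
  rewrite setI_bigcupr measure_semi_bigcup//.
  + by apply: eq_eseriesr => k _; exact: (KW k).2.
  + by move=> k; apply: measurableI => //; exact: (KW k).1.
  + exact: trivIset_setIl.
  + apply: bigcup_measurable => k _; apply: measurableI => //.
    exact: (KW k).1.
Qed.

End sub_sigma_algebra_order.

(** * Conditional independence as a semigraphoid *)

Section conditional_independence_model.
Context d d' (T : measurableType d) (E : measurableType d') (R : realType).
Context (P : probability T R) (V : finType) (X : V -> {RV P >-> E}).
Implicit Types A B C : {set V}.

Lemma events_of_measurable A : events_of X A `<=` measurable.
Proof. by move=> _ [v _ [B mB <-]]; exact: measurable_funP. Qed.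

Lemma events_of_gen_measurable A : <<s events_of X A >> `<=` measurable.
Proof. exact: g_sigma_algebra_measurable (@events_of_measurable A). Qed.

Lemma events_ofS A B : A \subset B -> events_of X A `<=` events_of X B.
Proof. by move=> /fintype.subsetP AB; apply: bigcup_subset => v /= /AB. Qed.

Lemma events_ofS_gen A B :
  A \subset B -> <<s events_of X A >> `<=` <<s events_of X B >>.
Proof.
move=> AB; apply: smallest_sub; first exact: smallest_sigma_algebra.
by move=> W AW; apply: sub_sigma_algebra; exact: events_ofS AW.
Qed.

(** The version f knows X_C only, yet it predicts S as well as X_B and X_C
together do. In this form B and C occur through their union, besides the
measurability of f, which makes decomposition and weak union plain
monotonicity. *)
Lemma cond_indepP A B C :
  cond_indep X A B C <->
  forall S : set T, (events_of X A).-sigma.-measurable S ->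
    exists f : T -> R,
      [/\ forall x, 0 <= f x,
          measurable_fun [set: g_sigma_algebraType (events_of X C)]
            (f : g_sigma_algebraType (events_of X C) -> R) &
          is_cond_prob P (events_of X (B :|: C)) S f].
Proof.
have m := events_of_gen_measurable.
have mev := events_of_measurable.
have CBC : events_of X C `<=` <<s events_of X (B :|: C) >>.
  move=> D CD; apply: sub_sigma_algebra.
  by apply: events_ofS CD; exact: finset.subsetUr.
split=> [ABC S mS|ABC S U mS mU].
  have [f [f0 cf _]] := cond_prob_ex P (mev C) (m _ _ mS).
  have [mf intf _] := cf.
  exists f; split => //; split => //; first exact: measurable_fun_coarser mf.
  (* The pi-system is formed by the intersections of an event of X_B with an
     event of X_C. *)
  pose H := [set W | exists U D, [/\ <<s events_of X B >> U,
    <<s events_of X C >> D & W = U `&` D]].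
  have sH : events_of X (B :|: C) `<=` H.
    move=> D [v /=]; rewrite finset.in_setU => /orP[vB|vC] Dv.
      exists D, setT; split; rewrite ?setIT//; last exact: g_sigma_algebraT.
      by apply: sub_sigma_algebra; exists v.
    exists setT, D; split; rewrite ?setTI//; first exact: g_sigma_algebraT.
    by apply: sub_sigma_algebra; exists v.
  move=> D mD.
  apply: (integral_g_sigma_algebra (H := H)).
  - move=> _ _ [U1 [D1 [mU1 mD1 ->]]] [U2 [D2 [mU2 mD2 ->]]].
    exists (U1 `&` U2), (D1 `&` D2); split; last by rewrite setIACA.
      exact: g_sigma_algebraI.
    exact: g_sigma_algebraI.
  - exists setT, setT; split; rewrite ?setIT//.
      exact: g_sigma_algebraT.
    exact: g_sigma_algebraT.
  - by move=> _ [U' [D' [/m mU' /m mD' ->]]]; exact: measurableI.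
  - exact: m mS.
  - by [].
  - by apply: measurable_fun_coarse mf; exact: events_of_measurable.
  - move=> _ [U [W [mU mW ->]]].
    have [g [g0 cg pull]] := cond_prob_ex P (mev C) (m _ _ mU).
    have [f1 [g1 [h [cf1 cg1 [mh inth Ih] hE]]]] := ABC S U mS mU.
    rewrite setIC -pull// [W `&` U]setIC setIA -Ih//.
    apply: ae_eq_integral.
    + exact: m mW.
    + apply/measurable_funTS/measurable_EFinP.
      apply: (measurable_fun_coarse (mev C)).
      by case: cg => mg _ _; exact: measurable_funM.
    + apply/measurable_funTS/measurable_EFinP.
      exact: (measurable_fun_coarse (mev C)).
    + have ff1 := cond_prob_ae_unique (mev C) cf cf1.
      have gg1 := cond_prob_ae_unique (mev C) cg cg1.
      apply: filterS3 ff1 gg1 hE => x /= -> -> -> _ //.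
  - apply: (smallest_sub (smallest_sigma_algebra _ _) _ mD) => W /sH.
    exact: sub_sigma_algebra.
have [f [f0 mf cf]] := ABC S mS.
have [g [g0 cg pull]] := cond_prob_ex P (mev C) (m _ _ mU).
have [_ intf If] := cf.
have mg : measurable_fun [set: g_sigma_algebraType (events_of X C)]
  (g : g_sigma_algebraType (events_of X C) -> R) by case: cg.
have mfg : measurable_fun [set: g_sigma_algebraType (events_of X C)]
  ((f \* g) : g_sigma_algebraType (events_of X C) -> R).
  exact: measurable_funM.
exists f, g, (f \* g); split => //.
- exact: (cond_prob_coarser CBC).
- split => //.
  + apply/integrableP; split.
      apply/measurable_EFinP.
      exact: (measurable_fun_coarse (mev C)).
    under eq_integral.
      move=> x _ /=; rewrite ger0_norm ?mulr_ge0//; over.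
    rewrite pull//.
    have /integrableP[_] : P.-integrable (setT `&` U) (EFin \o f).
      by apply: integrableS intf; rewrite ?setTI//; exact: m mU.
    apply: le_lt_trans; rewrite le_eqVlt; apply/orP; left; apply/eqP.
    by apply: eq_integral => x _ /=; rewrite ger0_norm.
  + move=> D mD; rewrite pull// If; last first.
    apply: g_sigma_algebraI.
      exact: (events_ofS_gen (finset.subsetUr B C) mD).
    exact: (events_ofS_gen (finset.subsetUl B C) mU).
    by rewrite setIAC setIA.
- exact: aeW.
Qed.

End conditional_independence_model.
Arguments events_of_measurable {d d' T E R P V}.
Arguments events_of_gen_measurable {d d' T E R P V}.

Section graphoid_axioms.
Context d d' (T : measurableType d) (E : measurableType d') (R : realType).
Context (P : probability T R) (V : finType) (X : V -> {RV P >-> E}).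
Implicit Types A B C : {set V}.

Lemma cond_indep_weaken A B C A' B' C' :
  A' \subset A -> C \subset C' -> B' :|: C' \subset B :|: C ->
  cond_indep X A B C -> cond_indep X A' B' C'.
Proof.
move=> AA CC BC /cond_indepP ABC; apply/cond_indepP => S mS.
have [f [f0 mf cf]] := ABC _ (events_ofS_gen AA mS).
have sub A1 A2 : A1 \subset A2 ->
    events_of X A1 `<=` <<s events_of X A2 >>.
  by move=> /events_ofS s12 D /s12; exact: sub_sigma_algebra.
exists f; split=> //; first exact: measurable_fun_coarser (sub _ _ CC) mf.
apply: cond_prob_coarser (sub _ _ BC) _ cf.
apply: measurable_fun_coarser mf; apply: sub.
exact: fintype.subset_trans CC (finset.subsetUr _ _).
Qed.

Lemma cond_indep_sym A B C : cond_indep X A B C -> cond_indep X B A C.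
Proof.
move=> ABC S U mS mU; have [f [g [h [cf cg ch hE]]]] := ABC U S mU mS.
exists g, f, h; split=> //; first by rewrite setIC.
by apply: filterS hE => x ->; rewrite mulrC.
Qed.

Lemma cond_indep0r A C : cond_indep X A finset.set0 C.
Proof.
apply/cond_indepP => S mS; rewrite finset.set0U.
have mS' := events_of_gen_measurable X A _ mS.
have [f [f0 cf _]] := cond_prob_ex P (events_of_measurable X C) mS'.
by exists f; split=> //; case: cf.
Qed.

End graphoid_axioms.

(** * Dependence on the law only *)

Section image_of_conditional_probability.
Context d d' (T : measurableType d) (W : measurableType d') (R : realType).
Context (P : probability T R) (Q : probability W R) (Z : {mfun T >-> W}).
Hypothesis lawZ : forall B : set W, measurable B -> distribution P Z B = Q B.

Lemma cond_prob_comp (H : set (set W)) (F : set W) (f : W -> R) :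
  H `<=` measurable -> measurable F ->
  is_cond_prob Q H F f ->
  is_cond_prob P (preimage_set_system setT Z H) (Z @^-1` F) (f \o Z).
Proof.
move=> Hm mF [mf intf If].
have mfW : measurable_fun setT (EFin \o f).
  exact/measurable_EFinP/(measurable_fun_coarse Hm).
have intfZ : P.-integrable setT (EFin \o (f \o Z)).
  apply/integrableP; split; first exact: measurableT_comp mfW _.
  have /integrableP[_] := intf.
  rewrite -(eq_measure_integral Q (m1 := distribution P Z)); last first.
    by move=> A mA _; exact: lawZ.
  by rewrite ge0_integral_pushforward//; exact: measurableT_comp.
split=> //.
- move=> _ Y mY; rewrite setTI.
  rewrite [X in X _](_ : _ = <<s preimage_set_system setT Z H >>)//.
  rewrite g_sigma_preimageE; exists (f @^-1` Y); last by rewrite setTI.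
  by rewrite -[f @^-1` _]setTI; exact: mf.
- move=> D; rewrite [X in X _](_ : _ = <<s preimage_set_system setT Z H >>)//.
  rewrite g_sigma_preimageE => -[D' mD' <-]; rewrite setTI.
  have mD'W := g_sigma_algebra_measurable Hm mD'.
  have mZD' : measurable (Z @^-1` D').
    by rewrite -[_ @^-1` _]setTI; exact: measurable_funP.
  rewrite -preimage_setI; transitivity (distribution P Z (F `&` D')) => //.
  rewrite lawZ; last exact: measurableI.
  rewrite -If// -(eq_measure_integral Q (m1 := distribution P Z)); last first.
    by move=> A mA _; exact: lawZ.
  rewrite (integral_pushforward _ mfW)//.
  exact: integrableS intfZ.
Qed.

End image_of_conditional_probability.

Section law.
Context d d' (T : measurableType d) (E : measurableType d') (R : realType).
Context (P : probability T R) (V : finType).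
Implicit Types (X Y : V -> {RV P >-> E}) (A B C : {set V}).

(** The events on the space of vectors that generate the sigma-algebra of the
coordinates in A; a random vector X pulls them back to [events_of X A]. *)
Let coord A : set (set (g_sigma_algebraType (@cylinders _ E V))) :=
  \bigcup_(v in [set` A]) preimage_set_system setT (fun y => y v) measurable.

Let coord_measurable A : coord A `<=` measurable.
Proof.
by move=> _ [v _ [B mB <-]]; apply: sub_sigma_algebra; exists v => //; exists B.
Qed.

Let events_ofE X A :
  events_of X A = preimage_set_system setT (random_vector X) (coord A).
Proof.
apply/seteqP; split=> [_ [v vA [B mB <-]]|_ [_ [v vA [B mB <-]] <-]].
  exists ((fun y => y v) @^-1` B); last by rewrite !setTI.
  by exists v => //; exists B => //; rewrite setTI.
by exists v => //; exists B => //; rewrite !setTI.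
Qed.

Lemma measurable_random_vector X : measurable_fun setT (random_vector X).
Proof.
apply: (@measurability _ _ T (g_sigma_algebraType (@cylinders _ E V)) _ _
  (@cylinders _ E V) erefl) => _ [_ [v _ [B mB <-]] <-].
rewrite !setTI -[X in measurable X]setTI.
exact: (measurable_funP (X v)).
Qed.

HB.instance Definition _ X :=
  isMeasurableFun.Build _ _ _ _ (random_vector X) (measurable_random_vector X).

(** On the space of vectors, with the common law Q, take versions f, g, h of the
conditional probabilities of S', U' and their intersection. Composed with X
they are versions for X, so independence says that h = f * g holds Q-almost
everywhere; this is a statement about Q only, and composing with Y gives
independence for Y. *)
Lemma cond_indep_law X Y A B C :
  (forall D, measurable D ->
    pushforward P (random_vector Y) D = pushforward P (random_vector X) D) ->
  cond_indep X A B C -> cond_indep Y A B C.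
Proof.
move=> lawYX ABC S U mSY mUY.
pose Q : probability _ R := distribution P (random_vector X).
have : <<s events_of Y B >> U by []; have : <<s events_of Y A >> S by [].
rewrite (events_ofE Y A) (events_ofE Y B) !g_sigma_preimageE.
move=> [S' mS <-] [U' mU <-] {S U mSY mUY}.
rewrite !setTI -preimage_setI.
have mS' := g_sigma_algebra_measurable (@coord_measurable A) mS.
have mU' := g_sigma_algebra_measurable (@coord_measurable B) mU.
have mSU' : measurable (S' `&` U') by exact: measurableI.
have [f [_ cf _]] := cond_prob_ex Q (@coord_measurable C) mS'.
have [g [_ cg _]] := cond_prob_ex Q (@coord_measurable C) mU'.
have [h [_ ch _]] := cond_prob_ex Q (@coord_measurable C) mSU'.
have lift (Z : V -> {RV P >-> E}) F k : (forall D, measurable D ->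
    distribution P (random_vector Z) D = Q D) -> measurable F ->
    is_cond_prob Q (coord C) F k ->
    is_cond_prob P (events_of Z C) (random_vector Z @^-1` F)
      (k \o random_vector Z).
  move=> lawZ mF ck; rewrite events_ofE.
  exact: (cond_prob_comp lawZ (@coord_measurable C)).
exists (f \o random_vector Y), (g \o random_vector Y), (h \o random_vector Y).
split; [exact: (lift Y _ f lawYX mS' cf)|exact: (lift Y _ g lawYX mU' cg)
  |exact: (lift Y _ h lawYX mSU' ch)|].
pose N := [set y | (h y)%:E != (f y * g y)%:E].
have mN : measurable N.
  rewrite -[N]setTI; apply: measurable_neqe => //; apply/measurable_EFinP.
    by apply: (measurable_fun_coarse (@coord_measurable C)); case: ch.
  apply: (measurable_fun_coarse (@coord_measurable C)).
  by apply: measurable_funM; [case: cf|case: cg].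
have mNZ (Z : V -> {RV P >-> E}) : measurable (random_vector Z @^-1` N).
  by rewrite -[_ @^-1` _]setTI; exact: (@measurable_random_vector Z).
have PN : P (random_vector X @^-1` N) = 0%E.
  have mSX : <<s events_of X A >> (random_vector X @^-1` S').
    rewrite events_ofE g_sigma_preimageE.
    by exists S' => //; rewrite setTI.
  have mUX : <<s events_of X B >> (random_vector X @^-1` U').
    rewrite events_ofE g_sigma_preimageE.
    by exists U' => //; rewrite setTI.
  have [f1 [g1 [h1 [cf1 cg1 ch1 hE]]]] := ABC _ _ mSX mUX.
  have uniq := cond_prob_ae_unique (P := P) (events_of_measurable X C).
  have ff1 := uniq _ _ _ (lift X _ _ (fun _ _ => erefl) mS' cf) cf1.
  have gg1 := uniq _ _ _ (lift X _ _ (fun _ _ => erefl) mU' cg) cg1.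
  have hh1 := uniq _ _ _ (lift X _ _ (fun _ _ => erefl) mSU' ch) ch1.
  apply/negligibleP => //.
  suff : {ae P, forall x, (h \o random_vector X) x =
      (f \o random_vector X) x * (g \o random_vector X) x}.
    apply: negligibleS => x /= /eqP hfg; apply: contra_not hfg => ->//.
  near=> x; rewrite (near ff1 x)// (near gg1 x)// (near hh1 x)//.
  by rewrite (near hE x).
exists (random_vector Y @^-1` N); split=> //.
  by rewrite -PN; exact: lawYX.
by move=> x /= hfg; apply: contra_notN hfg => /eqP[].
Unshelve. all: by end_near.
Qed.

End law.

(** * Exchangeable vectors *)

Section exchangeability.
Context d d' (T : measurableType d) (E : measurableType d') (R : realType).
Context (P : probability T R) (V : finType) (X : V -> {RV P >-> E}).
Implicit Types A B C : {set V}.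

(** The events of the vector X permuted by s, at A, are those of X at s @: A. *)
Lemma exchangeable_cond_indep (s : {perm V}) A B C : exchangeable X ->
  cond_indep X A B C -> cond_indep X (s @: A) (s @: B) (s @: C).
Proof.
move=> X_exch ABC.
have sE A' : events_of X (s @: A') = events_of (fun v => X (s v)) A'.
  apply/seteqP; split=> [D [_ /imsetP[v vA ->] Dv]|D [v vA Dv]].
    by exists v.
  by exists (s v) => //=; exact: imset_f.
have := cond_indep_law (X_exch s) ABC.
by rewrite /cond_indep !sE.
Qed.

Lemma cond_indep_semigraphoid :
  exchangeable X -> exchangeable_semigraphoid (cond_indep X).
Proof.
move=> X_exch; split.
- exact: cond_indep_sym.
- exact: cond_indep_weaken.
- exact: cond_indep0r.
- by move=> s A B C; exact: exchangeable_cond_indep.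
Qed.

End exchangeability.

Theorem theorem1 (d d' : measure_display) (T : measurableType d)
    (E : measurableType d') (R : realType) (P : probability T R)
    (V : finType) (X : V -> {RV P >-> E}) (X_exch : exchangeable X) :
  [/\ (exists G : sgraph V, faithful_undirected X G /\ faithful_bidirected X G)
        <-> intersection_property X /\ composition_property X,
      (exists G : sgraph V, faithful_undirected X G)
        <-> intersection_property X /\ composition_property X,
      (exists G : sgraph V, faithful_bidirected X G)
        <-> intersection_property X /\ composition_property X &
      forall G : sgraph V, faithful_undirected X G \/ faithful_bidirected X G ->
        empty_graph G \/ complete_graph G].
Proof.
have Iex := cond_indep_semigraphoid X_exch.
have ex_graph : intersection_property X /\ composition_property X ->
    exists G : sgraph V, faithful_undirected X G /\ faithful_bidirected X G.
  by case=> Xint Xcomp; exact: faithful_graph_ex Iex Xint Xcomp.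
have u_graphoid (G : sgraph V) : faithful_undirected X G ->
    intersection_property X /\ composition_property X.
  move=> GX; split.
    exact: (agree_intersective GX (@usep_intersective _ G)).
  exact: (agree_compositional GX (@usep_compositional _ G)).
have b_graphoid (G : sgraph V) : faithful_bidirected X G ->
    intersection_property X /\ composition_property X.
  move=> GX; split.
    exact: (agree_intersective GX (@bsep_intersective _ G)).
  exact: (agree_compositional GX (@bsep_compositional _ G)).
split.
- by split=> [[G [/u_graphoid]]|/ex_graph].
- by split=> [[G /u_graphoid]|/ex_graph[G [GX _]]] //; exists G.
- by split=> [[G /b_graphoid]|/ex_graph[G [_ GX]]] //; exists G.
- by move=> G; exact: (exchangeable_faithful_graph Iex).
Qed.
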